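(* Let $R_1,R_2$ be commutative rings with $1$, let $M$ be an $(R_1,R_2)$-bimodule, and let $R=\begin{pmatrix}R_1&M\\0&R_2\end{pmatrix}$. Let $m:=\min\{n\in\mathbb N\mid na=0\text{ for all }a\in M\}$, with $m:=0$ if this set is empty. Then for all $n\geqslant2$ there is an isomorphism of $\mathbb ZS_n$-modules $$\frac{\Gamma_n(\mathbb Z)}{\Gamma_n(\mathbb Z)\cap\operatorname{Id}(R,\mathbb Z)}\cong S(\lambda)/mS(\lambda),\qquad\text{where }\lambda=(n-1,1).$$
   Context: $\mathbb N=\{1,2,\dots\}$. Bimodules are unital. $\mathbb Z\langle X\rangle$ is the free associative ring without $1$ on $X=\{x_1,x_2,\dots\}$. $\operatorname{Id}(R,\mathbb Z)\subseteq\mathbb Z\langle X\rangle$ is the set of $f$ with $f(a_1,\dots,a_n)=0$ for all $a_i\in R$. $P_n(\mathbb Z)$ is the additive subgroup of $\mathbb Z\langle X\rangle$ generated by $x_{\sigma(1)}\cdots x_{\sigma(n)}$, $\sigma\in S_n$; $S_n$ acts by permuting the variables. $\Gamma_n(\mathbb Z)\subseteq P_n(\mathbb Z)$ is the $\mathbb ZS_n$-submodule of proper polynomials, i.e. of linear combinations of products of long commutators (of length $\geqslant2$, left normed: $[x,y,z]=[[x,y],z]$). For a Young tableau $T_\lambda$ of shape $\lambda\vdash n$ with row stabilizer $R_{T_\lambda}$ and column stabilizer $C_{T_\lambda}$, let $a_{T_\lambda}=\sum_{\pi\in R_{T_\lambda}}\pi$, $b_{T_\lambda}=\sum_{\sigma\in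 C_{T_\lambda}}(\operatorname{sign}\sigma)\sigma$; the integral Specht module is $S(\lambda):=(\mathbb ZS_n)b_{T_\lambda}a_{T_\lambda}$, which up to isomorphism does not depend on $T_\lambda$. *)

(* Defs.v *)
From HB Require Import structures.
From mathcomp Require Import all_boot all_order all_algebra all_fingroup.
From mathcomp Require Import generic_quotient ring_quotient.
From mathcomp Require Import boolp.
From mathcomp Require Import finmap monalg.

Set Implicit Arguments.
Unset Strict Implicit.
Unset Printing Implicit Defensive.

Import GRing.Theory Num.Theory.

Local Open Scope ring_scope.
Local Open Scope quotient_scope.

(* An (R, S)-bimodule: a left R-module with a commuting unital right S-action. *)
HB.mixin Record Lmodule_isBimodule (R S : pzRingType) M
    of GRing.Lmodule R M := {
  ract : M -> S -> M;
  ractDl : forall b, {morph ract^~ b : x y / x + y};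
  ractDr : forall x, {morph ract x : b c / b + c};
  ractA : forall x b c, ract x (b * c) = ract (ract x b) c;
  ract1 : forall x, ract x 1 = x;
  scale_ract : forall a x b, a *: ract x b = ract (a *: x) b
}.

#[short(type="bimodType")]
HB.structure Definition Bimodule (R S : pzRingType) :=
  {M of Lmodule_isBimodule R S M & GRing.Lmodule R M}.

Section Triangular.
Variables (R S : pzRingType) (M : bimodType R S).
Implicit Types (x y : M) (b c : S).

(* ((a, x), b) stands for the matrix with rows (a, x) and (0, b). *)
Definition triang : Type := (R * M * S)%type.

HB.instance Definition _ := GRing.Zmodule.on triang.

Definition triang_mul (A B : triang) : triang :=
  (A.1.1 * B.1.1, A.1.1 *: B.1.2 + ract A.1.2 B.2, A.2 * B.2).

Definition triang_one : triang := (1, 0, 1).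

Lemma ract0l b : ract (0 : M) b = 0.
Proof. by apply: (addrI (ract 0 b)); rewrite -ractDl !addr0. Qed.

Lemma ract0r x : ract x (0 : S) = 0.
Proof. by apply: (addrI (ract x 0)); rewrite -ractDr !addr0. Qed.

Fact triang_mulA : associative triang_mul.
Proof.
move=> [[a x] b] [[a' x'] b'] [[a'' x''] b''].
rewrite /triang_mul /= !mulrA; congr (_, _, _).
by rewrite scalerDr ractDl scalerA ractA scale_ract addrA.
Qed.

Fact triang_mul1l : left_id triang_one triang_mul.
Proof.
by move=> [[a x] b]; rewrite /triang_mul /= !mul1r scale1r ract0l addr0.
Qed.

Fact triang_mul1r : right_id triang_one triang_mul.
Proof.
by move=> [[a x] b]; rewrite /triang_mul /= !mulr1 scaler0 ract1 add0r.
Qed.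

Fact triang_mulDl : left_distributive triang_mul +%R.
Proof.
move=> [[a x] b] [[a' x'] b'] [[a'' x''] b''].
rewrite /triang_mul /= !mulrDl; congr (_, _, _).
by rewrite scalerDl ractDl addrACA.
Qed.

Fact triang_mulDr : right_distributive triang_mul +%R.
Proof.
move=> [[a x] b] [[a' x'] b'] [[a'' x''] b''].
rewrite /triang_mul /= !mulrDr; congr (_, _, _).
by rewrite scalerDr ractDr addrACA.
Qed.

HB.instance Definition _ := GRing.Zmodule_isPzRing.Build triang
  triang_mulA triang_mul1l triang_mul1r triang_mulDl triang_mulDr.

End Triangular.

Definition zmod_exponent (M : zmodType) : nat :=
  if pselect (exists k, `[< (0 < k)%N /\ forall a : M, a *+ k = 0 >])
    is left h then ex_minn h else 0%N.

Section GroupRing.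
Variable n : nat.

Definition ZS : Type := {ffun 'S_n -> int}.

HB.instance Definition _ := GRing.Zmodule.on ZS.

Definition gr (s : 'S_n) : ZS := [ffun t => (t == s)%:R].

(* The product extends composition of functions, (s o t) i = s (t i), whereas *)
(* s * t in 'S_n maps i to t (s i).                                           *)
Definition gr_mul (z w : ZS) : ZS :=
  [ffun s => \sum_(t : 'S_n) z t * w (s * t^-1)%g].

Fact gr_mulA : associative gr_mul.
Proof.
move=> x y z; apply/ffunP=> s; rewrite !ffunE.
under eq_bigr => t _ do rewrite ffunE mulr_sumr.
under [RHS]eq_bigr => t _ do rewrite ffunE mulr_suml.
rewrite [RHS]exchange_big /=; apply: eq_bigr => t _.
rewrite [RHS](reindex_inj (mulIg t)) /=; apply: eq_bigr => u _.
by rewrite mulgK invMg !mulgA mulrA.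
Qed.

Fact gr_mul1l : left_id (gr 1) gr_mul.
Proof.
move=> x; apply/ffunP=> s; rewrite !ffunE (bigD1 1%g) //= big1.
  by rewrite !ffunE eqxx mul1r addr0 invg1 mulg1.
by move=> t /negPf tn; rewrite !ffunE tn mul0r.
Qed.

Fact gr_mul1r : right_id (gr 1) gr_mul.
Proof.
move=> x; apply/ffunP=> s; rewrite !ffunE (bigD1 s) //= big1.
  by rewrite !ffunE mulgV eqxx mulr1 addr0.
move=> t tn; rewrite !ffunE; case: eqP => [/(canRL (mulgK _))|]; last first.
  by rewrite mulr0.
by rewrite invgK mul1g => e; rewrite e eqxx in tn.
Qed.

Fact gr_mulDl : left_distributive gr_mul +%R.
Proof.
move=> x y z; apply/ffunP=> s; rewrite !ffunE -big_split.
by apply: eq_bigr => t _; rewrite !ffunE mulrDl.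
Qed.

Fact gr_mulDr : right_distributive gr_mul +%R.
Proof.
move=> x y z; apply/ffunP=> s; rewrite !ffunE -big_split.
by apply: eq_bigr => t _; rewrite !ffunE mulrDr.
Qed.

HB.instance Definition _ := GRing.Zmodule_isPzRing.Build ZS
  gr_mulA gr_mul1l gr_mul1r gr_mulDl gr_mulDr.

End GroupRing.

Section SubQuotient.
Variables (A : pzRingType) (V : lmodType A).

Definition submod (U : submodClosed V) : Type := {x : V | x \in U}.

HB.instance Definition _ (U : submodClosed V) := SubChoice.on (submod U).
HB.instance Definition _ (U : submodClosed V) :=
  [SubChoice_isSubLmodule of submod U by <:].

Variables U W : submodClosed V.

Definition subpre : {pred submod U} := fun x => val x \in W.

Fact subpre_closed : submod_closed subpre.
Proof.
split=> [|a x y xW yW]; rewrite unfold_in /subpre ?raddf0 ?rpred0 //.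
by rewrite linearP rpredD // rpredZ.
Qed.

HB.instance Definition _ := GRing.isSubmodClosed.Build A (submod U) subpre
  subpre_closed.

(* The quotient U / W, for W a submodule of U (in general, U / (U :&: W)). *)
Definition quotmod : Type := Quotient.quot subpre.

HB.instance Definition _ := GRing.Zmodule.on quotmod.

Local Notation pi := (\pi_(Quotient.quot subpre)).

Definition quot_scale (a : A) (x : quotmod) : quotmod := pi (a *: repr x).

Lemma pi_scale a (x : submod U) : quot_scale a (pi x) = pi (a *: x).
Proof.
apply/eqP; rewrite /quot_scale -Quotient.idealrBE -scalerBr.
by rewrite rpredZ // Quotient.idealrBE reprK.
Qed.

Fact quot_scaleA a b x : quot_scale a (quot_scale b x) = quot_scale (a * b) x.
Proof.
by rewrite -[x](@reprK _ (Quotient.quot subpre)) !pi_scale scalerA.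
Qed.

Fact quot_scale1 : left_id 1 quot_scale.
Proof.
by move=> x; rewrite -[x](@reprK _ (Quotient.quot subpre)) pi_scale scale1r.
Qed.

Fact quot_scaleDr : right_distributive quot_scale +%R.
Proof.
move=> a x y; rewrite -[x](@reprK _ (Quotient.quot subpre)).
rewrite -[y](@reprK _ (Quotient.quot subpre)).
by rewrite -raddfD !pi_scale -raddfD scalerDr.
Qed.

Fact quot_scaleDl x : {morph quot_scale^~ x : a b / a + b}.
Proof.
move=> a b; rewrite -[x](@reprK _ (Quotient.quot subpre)).
by rewrite !pi_scale -raddfD scalerDl.
Qed.

HB.instance Definition _ := GRing.Zmodule_isLmodule.Build A quotmod
  quot_scaleA quot_scale1 quot_scaleDr quot_scaleDl.

End SubQuotient.

(* The additive subgroup generated by G. *)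
Inductive zspan (V : zmodType) (G : V -> Prop) : V -> Prop :=
| zspan0 : zspan G 0
| zspan_gen v : G v -> zspan G v
| zspanB u v : zspan G u -> zspan G v -> zspan G (u - v).

Section ZSpan.
Variables (V W : zmodType) (G : V -> Prop) (H : W -> Prop).

Lemma zspanN v : zspan G v -> zspan G (- v).
Proof. by move=> Gv; rewrite -[- v]add0r; apply: zspanB => //; exact: zspan0. Qed.

Lemma zspanD u v : zspan G u -> zspan G v -> zspan G (u + v).
Proof. by move=> Gu Gv; rewrite -[v]opprK; apply: zspanB => //; exact: zspanN. Qed.

Lemma zspanMz v c : zspan G v -> zspan G (v *~ c).
Proof.
move=> Gv; have GvM k : zspan G (v *+ k).
  by elim: k => [|k IHk]; rewrite ?mulrS; [exact: zspan0 | exact: zspanD].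
by case: c => k; [exact: GvM | apply/zspanN/GvM].
Qed.

Lemma zspan_sum (I : finType) (F : I -> V) :
  (forall i, zspan G (F i)) -> zspan G (\sum_i F i).
Proof. by move=> GF; elim/big_ind: _ => //; [exact: zspan0 | exact: zspanD]. Qed.

Lemma zspan_morph (f : {additive V -> W}) v :
  (forall u, G u -> H (f u)) -> zspan G v -> zspan H (f v).
Proof.
move=> GH; elim=> [|u Gu|u1 u2 _ H1 _ H2]; rewrite ?raddf0 ?raddfB.
- exact: zspan0.
- by apply: zspan_gen; exact: GH.
- exact: zspanB.
Qed.

End ZSpan.

(* The free ring with 1 on variables indexed by nat from 0; the free ring     *)
(* without 1 is its ideal of elements with zero constant term f@_1.           *)
Definition freering : Type := {malg int[{fmonom nat}]}.

HB.instance Definition _ := GRing.NzRing.on freering.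

Definition fvar (i : nat) : freering := << fmu i >>.

Section Eval.
Variable S : pzRingType.
Implicit Types (a : nat -> S) (f g : freering) (w : {fmonom nat}).

Definition mon_eval a w : S := \prod_(i <- w) a i.

Definition feval a f : S := \sum_(w <- msupp f) mon_eval a w *~ f@_w.

Lemma fevalEw (d : {fset {fmonom nat}}) a f : (msupp f `<=` d)%fset ->
  feval a f = \sum_(w <- d) mon_eval a w *~ f@_w.
Proof.
by move=> sfd; apply: big_fset_incl => // w _ /mcoeff_outdom ->.
Qed.

Lemma fevalU a (c : int) w : feval a << c *g w >> = mon_eval a w *~ c.
Proof. by rewrite (fevalEw _ msuppU_le) big_seq_fset1 mcoeffUU. Qed.

Fact feval_is_zmod_morphism a : zmod_morphism (feval a).
Proof.
move=> f g; set d := (msupp f `|` msupp g `|` msupp (f - g))%fset.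
rewrite !(@fevalEw d) /d ?fsubsetUr //.
- by rewrite -sumrB; apply: eq_bigr => w _; rewrite mcoeffB mulrzBr.
- by rewrite -fsetUA fsetUCA fsubsetUl.
- by rewrite -fsetUA fsubsetUl.
Qed.

HB.instance Definition _ a := GRing.isZmodMorphism.Build freering S (feval a)
  (feval_is_zmod_morphism a).

Lemma mon_evalM a w1 w2 : mon_eval a (mmul w1 w2) = mon_eval a w1 * mon_eval a w2.
Proof. by rewrite /mon_eval fmM big_cat. Qed.

Fact feval_is_monoid_morphism a : monoid_morphism (feval a).
Proof.
split=> [|f g]; first by rewrite fevalU /mon_eval fm1 big_nil.
rewrite malgM_def /fgmul raddf_sum /= mulr_suml; apply: eq_bigr => w1 _.
rewrite raddf_sum /= mulr_sumr; apply: eq_bigr => w2 _.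
by rewrite fevalU mon_evalM mulrzAl mulrzAr -mulrzA [(g@_w2 * _)%R]mulrC.
Qed.

HB.instance Definition _ a := GRing.isMonoidMorphism.Build freering S (feval a)
  (feval_is_monoid_morphism a).

Lemma eq_feval a b f : a =1 b -> feval a f = feval b f.
Proof. by move=> /funext ->. Qed.

Lemma feval_var a i : feval a (fvar i) = a i.
Proof. by rewrite fevalU /mon_eval fmU big_seq1. Qed.

End Eval.

Definition lie (S : pzRingType) (x y : S) : S := x * y - y * x.

(* The left-normed commutator [x_i, x_j, x_(k_1), ..., x_(k_r)], for s the    *)
(* list of the k's.                                                           *)
Definition long_comm (i j : nat) (s : seq nat) : freering :=
  foldl (@lie freering) (lie (fvar i) (fvar j)) [seq fvar k | k <- s].

Definition is_comm_product (f : freering) : Prop :=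
  exists2 cs : seq (nat * nat * seq nat), cs != [::] &
    f = \prod_(c <- cs) long_comm c.1.1 c.1.2 c.2.

Definition proper_poly : freering -> Prop := zspan is_comm_product.

Definition multilinear_monomial n (s : 'S_n) : freering :=
  \prod_(i < n) fvar (s i).

Definition multilinear n : freering -> Prop :=
  zspan (fun f => exists s : 'S_n, f = multilinear_monomial s).

Definition poly_identity (S : pzRingType) (f : freering) : Prop :=
  f@_mone = 0 /\ forall a : nat -> S, feval a f = 0.

(* A copy of the free ring for the left ZS n-module structure below, in which *)
(* s sends x_i to x_(s i).                                                    *)
Definition freemod (n : nat) : Type := freering.

HB.instance Definition _ n := GRing.Zmodule.on (freemod n).

Section PermAction.
Variable n : nat.
Implicit Types (s t : 'S_n) (f g : freering) (z w : ZS n).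

(* 'S_n acts on nat, fixing the numbers not less than n. *)
Definition perm_nat s (i : nat) : nat :=
  if insub i is Some j then s j else i.

Definition perm_vars s : freering -> freering := feval (fvar \o perm_nat s).

HB.instance Definition _ s := GRing.RMorphism.on (perm_vars s).

Lemma perm_nat_ord s (i : 'I_n) : perm_nat s i = s i.
Proof. by rewrite /perm_nat valK. Qed.

Lemma perm_natM s t i : perm_nat s (perm_nat t i) = perm_nat (t * s)%g i.
Proof.
rewrite {2 3}/perm_nat; case: insubP => [j _ _|ni]; last first.
  by rewrite /perm_nat insubN.
by rewrite perm_nat_ord permM.
Qed.

Lemma perm_nat1 i : perm_nat 1 i = i.
Proof. by rewrite /perm_nat; case: insubP => // j _ <-; rewrite perm1. Qed.

Lemma perm_vars_var s i : perm_vars s (fvar i) = fvar (perm_nat s i).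
Proof. exact: feval_var. Qed.

Lemma feval_perm_vars (S : pzRingType) (a : nat -> S) s f :
  feval a (perm_vars s f) = feval (a \o perm_nat s) f.
Proof.
rewrite /perm_vars {1}/feval -/(feval _ _) raddf_sum; apply: eq_bigr => w _ /=.
rewrite raddfMz /mon_eval /= rmorph_prod; congr (_ *~ _).
by apply: eq_bigr => i _ /=; rewrite feval_var.
Qed.

Lemma feval_fvar f : feval fvar f = f.
Proof.
rewrite [RHS]monalgE; apply: eq_bigr => w _.
have -> : mon_eval fvar w = << w >>.
  rewrite /mon_eval -[in RHS](fmK w); elim: (w : seq nat) => [|i v IHv].
    by rewrite big_nil -fmoneE.
  rewrite big_cons IHv [_ * _]fgmulUU mul1r; congr << _ >>.
  by apply/eqP; rewrite -val_eqE /= fmM fmU.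
by rewrite -(raddfMz (@mkmalgU _ _ w)) intz.
Qed.

Lemma perm_varsM s t f : perm_vars s (perm_vars t f) = perm_vars (t * s)%g f.
Proof.
rewrite {1}/perm_vars feval_perm_vars /perm_vars.
by apply: eq_feval => i /=; rewrite perm_natM.
Qed.

Lemma perm_vars1 f : perm_vars 1 f = f.
Proof.
rewrite -[RHS]feval_fvar /perm_vars.
by apply: eq_feval => i /=; rewrite perm_nat1.
Qed.

Definition ZS_scale (z : ZS n) (f : freemod n) : freemod n :=
  \sum_(s : 'S_n) perm_vars s f *~ z s.

Fact ZS_scaleA z w f : ZS_scale z (ZS_scale w f) = ZS_scale (z * w) f.
Proof.
rewrite /ZS_scale.
under eq_bigr => s _ do rewrite raddf_sum /= mulrz_suml.
under [RHS]eq_bigr => s _ do rewrite ffunE mulrz_sumr.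
rewrite [RHS]exchange_big /=; apply: eq_bigr => s _.
rewrite [RHS](reindex_inj (mulIg s)) /=; apply: eq_bigr => t _.
by rewrite mulgK raddfMz /= perm_varsM -mulrzA mulrC.
Qed.

Fact ZS_scale1 : left_id (1 : ZS n) ZS_scale.
Proof.
move=> f; rewrite /ZS_scale (bigD1 1%g) //= big1 => [|s /negPf sn1].
  by rewrite ffunE eqxx perm_vars1 addr0.
by rewrite ffunE sn1.
Qed.

Fact ZS_scaleDr : right_distributive ZS_scale +%R.
Proof.
move=> z f g; rewrite /ZS_scale -big_split; apply: eq_bigr => s _ /=.
by rewrite raddfD mulrzDl.
Qed.

Fact ZS_scaleDl f : {morph ZS_scale^~ f : z w / z + w}.
Proof.
move=> z w; rewrite /ZS_scale -big_split; apply: eq_bigr => s _ /=.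
by rewrite ffunE mulrzDr.
Qed.

HB.instance Definition _ := GRing.Zmodule_isLmodule.Build (ZS n) (freemod n)
  ZS_scaleA ZS_scale1 ZS_scaleDr ZS_scaleDl.

End PermAction.

Section ProperPolynomials.
Variable n : nat.

Lemma perm_vars_multilinear (s : 'S_n) f :
  multilinear n f -> multilinear n (perm_vars s f).
Proof.
apply: zspan_morph => _ [t ->]; exists (t * s)%g.
rewrite /multilinear_monomial /= rmorph_prod; apply: eq_bigr => i _ /=.
by rewrite perm_vars_var perm_nat_ord permM.
Qed.

Lemma perm_vars_long_comm (s : 'S_n) i j ks :
  perm_vars s (long_comm i j ks) =
  long_comm (perm_nat s i) (perm_nat s j) [seq perm_nat s k | k <- ks].
Proof.
have lieE f g : perm_vars s (lie f g) = lie (perm_vars s f) (perm_vars s g).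
  by rewrite /lie rmorphB !rmorphM.
rewrite /long_comm -!perm_vars_var -lieE; elim: ks (lie _ _) => //= k ks IHk f.
by rewrite IHk lieE perm_vars_var.
Qed.

Lemma perm_vars_proper (s : 'S_n) f : proper_poly f -> proper_poly (perm_vars s f).
Proof.
apply: zspan_morph => _ [cs cs0 ->].
exists [seq (perm_nat s c.1.1, perm_nat s c.1.2, [seq perm_nat s k | k <- c.2])
       | c <- cs]; first by case: cs cs0.
rewrite /= rmorph_prod big_map; apply: eq_bigr => c _ /=.
exact: perm_vars_long_comm.
Qed.

Definition proper_multilinear : {pred freemod n} :=
  fun f => `[< multilinear n f /\ proper_poly f >].

Fact proper_multilinear_closed : submod_closed proper_multilinear.
Proof.
split=> [|z f g /asboolP[fM fP] /asboolP[gM gP]]; apply/asboolP.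
  by split; exact: zspan0.
by split; apply: zspanD => //; apply: zspan_sum => s; apply: zspanMz;
  [exact: perm_vars_multilinear | exact: perm_vars_proper].
Qed.

HB.instance Definition _ := GRing.isSubmodClosed.Build (ZS n) (freemod n)
  proper_multilinear proper_multilinear_closed.

Variable S : pzRingType.

Definition proper_multilinear_Id : {pred freemod n} :=
  fun f : freemod n => (f \in proper_multilinear) && `[< poly_identity S f >].

Lemma mcoeff1_feval (f : freering) : f@_mone = feval (fun=> 0 : int) f.
Proof.
rewrite {1}[f]monalgE raddf_sum; apply: eq_bigr => w _ /=.
rewrite mcoeffU /mon_eval fmP fm1; case: (w : seq nat) => [|i v].
  by rewrite big_nil intz.
by rewrite big_cons mul0r mul0rz.
Qed.

Fact proper_multilinear_Id_closed : submod_closed proper_multilinear_Id.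
Proof.
split=> [|z f g /andP[fG /asboolP[f1 fI]] /andP[gG /asboolP[g1 gI]]].
  by apply/andP; split; [exact: rpred0 | apply/asboolP; split=> [|a]; rewrite raddf0].
apply/andP; split; first by rewrite rpredD // rpredZ.
apply/asboolP; split=> [|a].
  rewrite raddfD /= g1 addr0 raddf_sum big1 // => s _.
  by rewrite raddfMz /= mcoeff1_feval feval_perm_vars -mcoeff1_feval f1 mul0rz.
rewrite raddfD /= gI addr0 raddf_sum big1 // => s _.
by rewrite raddfMz /= feval_perm_vars fI mul0rz.
Qed.

HB.instance Definition _ := GRing.isSubmodClosed.Build (ZS n) (freemod n)
  proper_multilinear_Id proper_multilinear_Id_closed.

End ProperPolynomials.

Arguments proper_multilinear : clear implicits.
Arguments proper_multilinear_Id : clear implicits.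

Section Specht.
Variables (n : nat) (T : seq (seq 'I_n)).

(* T lists the rows of a filling of the diagram of la with 'I_n. *)
Definition is_tableau (la : seq nat) : bool :=
  (shape T == la) && perm_eq (flatten T) (enum 'I_n).

Definition tab_row (i : 'I_n) : nat := find (fun r => i \in r) T.
Definition tab_col (i : 'I_n) : nat := index i (nth [::] T (tab_row i)).

Definition row_stab : {set 'S_n} :=
  [set s : 'S_n | [forall i, tab_row (s i) == tab_row i]].
Definition col_stab : {set 'S_n} :=
  [set s : 'S_n | [forall i, tab_col (s i) == tab_col i]].

Definition row_sum : ZS n := \sum_(s in row_stab) gr s.
Definition col_sum : ZS n := \sum_(s in col_stab) gr s *~ (-1) ^+ s.

Definition specht : {pred (ZS n)^o} :=
  fun u => `[< exists z : ZS n, u = z * (col_sum * row_sum) >].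

Fact specht_closed : submod_closed specht.
Proof.
split=> [|a _ _ /asboolP[z ->] /asboolP[w ->]]; apply/asboolP.
  by exists 0; rewrite mul0r.
by exists (a * z + w); rewrite mulrDl -mulrA.
Qed.

HB.instance Definition _ := GRing.isSubmodClosed.Build (ZS n) (ZS n)^o
  specht specht_closed.

Definition specht_mul (m : nat) : {pred (ZS n)^o} :=
  fun u => `[< exists2 v, v \in specht & u = v *+ m >].

Fact specht_mul_closed m : submod_closed (specht_mul m).
Proof.
split=> [|a _ _ /asboolP[u uS ->] /asboolP[v vS ->]]; apply/asboolP.
  by exists 0; rewrite ?rpred0 ?mul0rn.
by exists (a *: u + v); rewrite ?rpredD ?rpredZ // mulrnDl scalerMnr.
Qed.

HB.instance Definition _ m := GRing.isSubmodClosed.Build (ZS n) (ZS n)^o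
  (specht_mul m) (specht_mul_closed m).

End Specht.

(* Main.v *)
Require Import Defs.
From HB Require Import structures.
From mathcomp Require Import all_boot all_order all_algebra all_fingroup.
Import GRing.Theory.
Local Open Scope ring_scope.
From mathcomp Require Import generic_quotient ring_quotient.
From mathcomp Require Import boolp finmap monalg.

Set Implicit Arguments.
Unset Strict Implicit.
Unset Printing Implicit Defensive.

(** For a polynomial [f] and a variable [x_j] let [c_j f] be the sum of the
coefficients of the monomials of [f] that end in [x_j] ([last_coef]).  The
theorem holds because these [n] integers are all that the ring [R] of
triangular matrices can see of a proper multilinear [f], and because the
vectors [(c_j f)_j] that occur are exactly those of sum zero, which form a
copy of the Specht module of the shape [(n-1, 1)].

Proper polynomials on [R].  Put [d_A x = a x - x b] for a matrix [A] with
diagonal [(a, b)].  As [R1] and [R2] are commutative, the commutator of [A]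
and [B] is strictly upper triangular, with corner [d_A m_B - d_B m_A]; a
further commutator with [C] applies [- d_C] to the corner; and a product of
two strictly upper triangular matrices is zero.  The same rules govern the
operators [(x, z) |-> (d_A x + z m_A, 0)] on the group M x Z: commutators of
them send [(x, z)] to [(z y, 0)] for a fixed [y], further commutators apply
[- d_C] to [y], and products of two such operators vanish.  So a proper [f]
has on [R] the corner that [f] has when it acts on M x Z and is applied to
[(0, 1)] ([feval_proper]).  There a word [x_(k_1) .. x_(k_n)] gives
[d_(k_1) .. d_(k_(n-1)) m_(k_n)], and the [d_k] commute, so that for a
multilinear word only its last letter matters.  Hence the corner of [f] is
[sum_j c_j f (prod_(k <> j) d_k) m_j] ([op_act_multilinear]).
Conversely [x_j |-> x e_12] and [x_k |-> e_11] for [k <> j] give [f] the corner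
[x *~ c_j f], so that [f] is an identity of [R] if and only if the exponent of
[M] divides all the [c_j f] ([poly_identity_triang]).

The Specht module.  Let [q] be the entry of the second row of the tableau
and [p] the entry above it.  The elements [sum_k c_k (sum_(s q = k) s)] of the
group ring, written [point_sum q c], form a permutation module Z^n, and the
generator of the Specht module is the one with [c = delta_q - delta_p]; hence
the Specht module is the set of those with [sum_k c_k = 0]
([point_sum_specht]).  The map [f |-> point_sum q (c_k f)_k] is
ZS_n-linear.  It sends proper polynomials into the Specht module, since
[sum_k c_k f = f(1, .., 1) = 0], and onto it, since
[[x_p, x_q, x_(k_1), .., x_(k_r)]] is sent to the generator up to sign
([specht_map_surj]).  By the criterion above it sends exactly the identities of
[R] into the multiples of [m] ([specht_map_mul]), and the isomorphism is the
induced map on quotients ([quotmod_iso]). *)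

(** * Quotient modules *)

(** [F] induces the map of the quotients; the last hypothesis makes this map
well defined and injective at once. *)
Lemma quotmod_iso (A : pzRingType) (V V' : lmodType A)
    (U W : submodClosed V) (U' W' : submodClosed V') (F : {linear V -> V'}) :
    (forall u, u \in U -> F u \in U') ->
    (forall u', u' \in U' -> exists2 u, u \in U & F u = u') ->
    (forall u, u \in U -> (F u \in W') = (u \in W)) ->
  exists phi : {linear quotmod U W -> quotmod U' W'}, bijective phi.
Proof.
move=> FU FS FW.
pose pi (u : submod U) : quotmod U W := \pi_(Quotient.quot (@subpre _ _ U W))%qT u.
pose pi' (u : submod U') : quotmod U' W' :=
  \pi_(Quotient.quot (@subpre _ _ U' W'))%qT u.
have piK (x : quotmod U W) : pi (repr x) = x by rewrite /pi reprK.
have piB u v : pi u - pi v = pi (u - v) by rewrite /pi raddfB.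
have pi'B u v : pi' u - pi' v = pi' (u - v) by rewrite /pi' raddfB.
pose F0 (u : submod U) : submod U' := Sub (F (val u)) (FU _ (valP u)).
have F0B u v : F0 u - F0 v = F0 (u - v).
  by apply: val_inj; rewrite /F0 /= !raddfB.
have F0E u v : (pi' (F0 u) == pi' (F0 v)) = (pi u == pi v).
  by rewrite -!Quotient.idealrBE F0B; exact: FW (valP (u - v)).
pose phi (x : quotmod U W) : quotmod U' W' := pi' (F0 (repr x)).
have phiE u : phi (pi u) = pi' (F0 u) by apply/eqP; rewrite F0E piK.
have phi_add : zmod_morphism phi.
  by move=> x y; rewrite -(piK x) -(piK y) piB !phiE pi'B F0B.
have phi_scale : scalable phi.
  move=> a x; rewrite -(piK x) phiE.
  have -> : a *: pi (repr x) = pi (a *: repr x) by exact: pi_scale.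
  have -> : a *: pi' (F0 (repr x)) = pi' (a *: F0 (repr x)) by exact: pi_scale.
  by rewrite phiE; congr pi'; apply: val_inj; rewrite /= !linearZ.
pose phiA := GRing.isZmodMorphism.Build _ _ phi phi_add.
pose phiZ := GRing.isScalable.Build A _ _ _ phi phi_scale.
pose phiL : {linear quotmod U W -> quotmod U' W'} := HB.pack phi phiA phiZ.
exists phiL => /=.
have phi_surj (y : quotmod U' W') : exists x, phi x = y.
  have [u uU Fu] := FS _ (valP (repr y)).
  have -> : y = pi' (F0 (Sub u uU)).
    have -> : F0 (Sub u uU) = repr y by apply: val_inj; rewrite /F0 !SubK.
    by rewrite /pi' reprK.
  by exists (pi (Sub u uU)).
have [g gK] := choice phi_surj.
exists g => // x; have /eqP := gK (phi x).
by rewrite -(piK x) -(piK (g _)) !phiE F0E => /eqP.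
Qed.

(** * Words and commutators *)

Definition word (w : seq nat) : freering := \prod_(k <- w) fvar k.

Lemma feval_word (S : pzRingType) (a : nat -> S) w :
  feval a (word w) = \prod_(k <- w) a k.
Proof. by rewrite rmorph_prod; apply: eq_bigr => k _; rewrite /= feval_var. Qed.

Definition perm_span (u : seq nat) : freering -> Prop :=
  zspan (fun f => exists2 w, perm_eq w u & f = word w).

Lemma multilinear_monomialE n (s : 'S_n) :
  multilinear_monomial s = word [seq val (s i) | i <- enum 'I_n].
Proof. by rewrite /word big_map enumT /multilinear_monomial [index_enum _]unlock. Qed.

(** Words with given letters, unlike permutations in ['S_n], can be followed
through the expansion of a commutator one letter at a time. *)
Lemma multilinearP n f : multilinear n f <-> perm_span (iota 0 n) f.
Proof.
split; apply: (@zspan_morph _ _ _ _ idfun) => ?.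
  case=> s ->; rewrite multilinear_monomialE.
  exists [seq val (s i) | i <- enum 'I_n] => //.
  rewrite -val_enum_ord (map_comp val s); apply: perm_map; apply: uniq_perm.
  - by rewrite map_inj_uniq ?enum_uniq //; exact: perm_inj.
  - exact: enum_uniq.
  by move=> i; rewrite mem_enum; apply/mapP; exists (s^-1 i)%g; rewrite ?mem_enum ?permKV.
case=> w wn ->.
have sz : size w = n by rewrite (perm_size wn) size_iota.
have w_lt (i : 'I_n) : (nth 0 w i < n)%N.
  have := mem_nth 0 (_ : i < size w)%N; rewrite sz (perm_mem wn) mem_iota /= add0n.
  by apply.
pose t (i : 'I_n) := Ordinal (w_lt i).
have t_inj : injective t.
  move=> i j /(congr1 val) /= /eqP; rewrite nth_uniq ?sz //.
    by move/eqP/val_inj.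
  by rewrite (perm_uniq wn) iota_uniq.
exists (perm t_inj); rewrite /word /multilinear_monomial (big_nth 0) sz big_mkord.
by apply: eq_bigr => i _; rewrite permE.
Qed.

Lemma lieBl (S : pzRingType) (x y z : S) : lie (x - y) z = lie x z - lie y z.
Proof. by rewrite /lie mulrBl mulrBr !opprB addrACA [RHS]addrACA [- _ + _]addrC. Qed.

Lemma perm_span_lie u k f :
  perm_span u f -> perm_span (k :: u) (lie f (fvar k)).
Proof.
elim=> [|_ [w wu ->]|g h _ IHg _ IHh].
- by rewrite /lie mul0r mulr0 subr0; exact: zspan0.
- apply: zspanB; apply: zspan_gen.
    exists (rcons w k); first by rewrite perm_rcons perm_cons.
    by rewrite /word -cats1 big_cat big_seq1.
  by exists (k :: w); rewrite ?perm_cons // /word big_cons.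
rewrite (@lieBl freering).
exact: zspanB IHg IHh.
Qed.

Lemma perm_span_long_comm i j ks : perm_span (i :: j :: ks) (long_comm i j ks).
Proof.
rewrite /long_comm.
have : perm_span [:: i; j] (lie (fvar i) (fvar j)).
  apply: zspanB; apply: zspan_gen.
    by exists [:: i; j] => //; rewrite /word !big_cons big_nil mulr1.
  exists [:: j; i]; first by rewrite (perm_catC [:: j] [:: i]).
  by rewrite /word !big_cons big_nil mulr1.
suff H u g : perm_span u g ->
    perm_span (u ++ ks) (foldl (@lie freering) g [seq fvar k | k <- ks]).
  by move/H.
elim: ks u g => [|k ks IHks] u g ug /=; first by rewrite cats0.
have /IHks := perm_span_lie k ug.
apply: (@zspan_morph _ _ _ _ idfun) => ? [w wu ->]; exists w => //.
by rewrite (perm_trans wu) //= -cat1s perm_catCA.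
Qed.

Lemma feval_lie (S : pzRingType) (a : nat -> S) f g :
  feval a (lie f g) = lie (feval a f) (feval a g).
Proof. by rewrite /lie raddfB; congr (_ - _); exact: rmorphM. Qed.

Lemma feval_long_comm (S : pzRingType) (a : nat -> S) i j ks :
  feval a (long_comm i j ks) =
  foldl (@lie S) (lie (a i) (a j)) [seq a k | k <- ks].
Proof.
rewrite /long_comm -(feval_var a i) -(feval_var a j) -feval_lie.
elim: ks (lie _ _) => //= k ks IHks f.
by rewrite IHks feval_lie feval_var.
Qed.

Lemma foldl_lie0 (S : pzRingType) (s : seq S) : foldl (@lie S) 0 s = 0.
Proof. by elim: s => //= x s IHs; rewrite /lie mul0r mulr0 subr0. Qed.

(** In particular the constant term of a proper polynomial and the sum of its
coefficients vanish. *)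
Lemma feval_proper_comm (S : comPzRingType) (a : nat -> S) f :
  proper_poly f -> feval a f = 0.
Proof.
elim=> [|_ [[//|c cs] _ ->]|g h _ g0 _ h0]; rewrite ?raddf0 //.
  rewrite big_cons rmorphM /= feval_long_comm /lie [a c.1.1 * _]mulrC subrr.
  by rewrite foldl_lie0 mul0r.
by rewrite raddfB /= g0 h0 subr0.
Qed.

(** * Evaluation that singles out the last letter *)

(** The relations between [e] and [v] are those of [e_11] and [x e_12] among
upper triangular matrices. *)
Section EdgePair.
Variables (S : pzRingType) (e v : S).
Hypotheses (ee : e * e = e) (ev : e * v = v) (ve : v * e = 0).

Definition edge_at (j k : nat) : S := if k == j then v else e.

Lemma edge_at_eq j : edge_at j j = v.
Proof. by rewrite /edge_at eqxx. Qed.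

Lemma edge_at_neq j k : j != k -> edge_at j k = e.
Proof. by rewrite /edge_at eq_sym => /negPf ->. Qed.

(** A letter other than [j] after the [j] would give the factor [v * e = 0]. *)
Lemma edge_at_word j w : uniq w -> j \in w ->
  feval (edge_at j) (word w) = v *+ (last 0%N w == j).
Proof.
rewrite feval_word.
have e_prod u : j \notin u ->
    \prod_(k <- u) edge_at j k = if u is [::] then 1 else e.
  elim: u => [|k u IHu]; rewrite ?big_nil // inE negb_or big_cons => /andP[jk ju].
  rewrite IHu // edge_at_neq //.
  by case: u {IHu ju} => [|k' u]; rewrite ?mulr1.
elim: w => // k w IHw /= /andP[kw w_uniq]; rewrite inE big_cons.
case: (eqVneq j k) => [jk _|jk /= jw].
  rewrite -{}jk in kw *; rewrite e_prod // edge_at_eq.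
  case: w kw {IHw w_uniq} => [|k' w] kw /=; first by rewrite eqxx mulr1.
  rewrite ve; case: eqP => [jl|]; last by rewrite mulr0n.
  by move: kw; rewrite -{1}jl mem_last.
rewrite IHw // edge_at_neq // mulrnAr ev.
by case: w jw {IHw kw w_uniq}.
Qed.

(** The commutator [e * v - v * e] is [v], and each further commutator with [e]
changes the sign. *)
Lemma edge_at_long_comm l i j ks : uniq [:: i, j & ks] ->
  feval (edge_at l) (long_comm i j ks) =
  v *~ ((-1) ^+ size ks * ((l == j)%:Z - (l == i)%:Z)).
Proof.
rewrite feval_long_comm /= inE negb_or => /andP[/andP[ij iks] /andP[jks _]].
have fold_v c : l \notin ks ->
    foldl (@lie S) (v *~ c) [seq edge_at l k | k <- ks] =
    v *~ ((-1) ^+ size ks * c).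
  elim: ks c {iks jks} => [|k ks IHks] c; rewrite ?expr0 ?mul1r //=.
  rewrite inE negb_or => /andP[lk lks].
  rewrite edge_at_neq // /lie mulrzAl mulrzAr ve ev mul0rz sub0r -mulrNz IHks //.
  by rewrite exprS mulN1r mulNr mulrN.
case: (eqVneq l j) => [lj|lj].
  rewrite lj in fold_v *; rewrite edge_at_eq edge_at_neq 1?eq_sym //.
  rewrite (negPf ij) /lie ev ve -(fold_v _ jks) ?subr0.
  by rewrite mulr1z.
case: (eqVneq l i) => [li|li].
  rewrite li in fold_v *; rewrite edge_at_eq edge_at_neq //.
  by rewrite /lie ev ve -(fold_v _ iks) !sub0r mulrNz mulr1z.
by rewrite !edge_at_neq // /lie subrr foldl_lie0 subrr mulr0.
Qed.

End EdgePair.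

Lemma delta_edge :
  [/\ delta_mx 0 0 * delta_mx 0 0 = delta_mx 0 0 :> 'M[int]_2,
      delta_mx 0 0 * delta_mx 0 1 = delta_mx 0 1 :> 'M[int]_2 &
      delta_mx 0 1 * delta_mx 0 0 = 0 :> 'M[int]_2].
Proof.
by split; rewrite -[LHS]/(_ *m _) ?mul_delta_mx // mul_delta_mx_0.
Qed.

(** The sum of the coefficients of the monomials of [f] that end in [x_j], for
[f] multilinear ([last_coef_word]); as a matrix entry it is visibly additive
and can be computed on commutators without expanding them. *)
Definition last_coef (j : nat) (f : freering) : int :=
  feval (edge_at (delta_mx 0 0 : 'M[int]_2) (delta_mx 0 1) j) f 0 1.

Fact last_coef_is_zmod_morphism j : zmod_morphism (last_coef j).
Proof. by move=> f g; rewrite /last_coef raddfB /= !mxE. Qed.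

HB.instance Definition _ j := GRing.isZmodMorphism.Build freering int
  (last_coef j) (last_coef_is_zmod_morphism j).

Lemma last_coef_word j w : uniq w -> j \in w ->
  last_coef j (word w) = (last 0%N w == j)%:R.
Proof.
move=> w_uniq jw; have [ee ev ve] := delta_edge.
by rewrite /last_coef edge_at_word // mulmxnE !mxE.
Qed.

Lemma last_coef_long_comm l i j ks : uniq [:: i, j & ks] ->
  last_coef l (long_comm i j ks) =
  (-1) ^+ size ks * ((l == j)%:Z - (l == i)%:Z).
Proof.
move=> ijks; have [ee ev ve] := delta_edge.
rewrite /last_coef edge_at_long_comm //.
by rewrite -scaler_int !mxE /= mulr1 intz.
Qed.

Lemma last_coef_perm n (s : 'S_n) j f :
  last_coef (perm_nat s j) (perm_vars s f) = last_coef j f.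
Proof.
rewrite /last_coef feval_perm_vars; congr (_ _ 0 1); apply: eq_feval => k /=.
rewrite /edge_at (inj_eq (can_inj (g := perm_nat s^-1) _)) // => i.
by rewrite perm_natM mulgV perm_nat1.
Qed.

(** A multilinear word is determined by its last letter as far as [F] can see,
so [F f] is obtained by collecting the monomials with the same last letter. *)
Lemma additive_last_coef (V : zmodType) (F : {additive freering -> V})
    (y : nat -> V) n f : (0 < n)%N ->
    (forall w, perm_eq w (iota 0 n) -> F (word w) = y (last 0%N w)) ->
  multilinear n f -> F f = \sum_(j < n) y j *~ last_coef j f.
Proof.
move=> n_gt0 Fy /multilinearP; elim=> [|_ [w wn ->]|g h _ IHg _ IHh].
- by rewrite raddf0 big1 // => j _; rewrite !raddf0.
- have mem_w k : (k \in w) = (k < n)%N by rewrite (perm_mem wn) mem_iota.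
  have w_uniq : uniq w by rewrite (perm_uniq wn) iota_uniq.
  have w_last : (last 0%N w < n)%N.
    rewrite -mem_w; case: w wn {mem_w w_uniq} => [|k w _]; last exact: mem_last.
    by move/perm_size; rewrite size_iota => n0; rewrite -n0 in n_gt0.
  rewrite (Fy _ wn) (bigD1 (Ordinal w_last)) //=.
  rewrite last_coef_word ?mem_w // eqxx mulr1z.
  rewrite big1 ?addr0 // => j; rewrite -val_eqE /= => jl.
  by rewrite last_coef_word ?mem_w // eq_sym (negPf jl) mulr0z.
rewrite raddfB /= IHg IHh -sumrB; apply: eq_bigr => j _.
by rewrite -mulrzBr -raddfB.
Qed.

Lemma sum_last_coef n f : (0 < n)%N -> multilinear n f ->
  \sum_(j < n) last_coef j f = feval (fun=> 1) f.
Proof.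
move=> n_gt0 fn.
rewrite (@additive_last_coef _ (feval (fun=> 1 : int)) (fun=> 1) n) //.
  by apply: eq_bigr => j _; rewrite intz.
by move=> w _; rewrite /= feval_word big1.
Qed.

(** Every triangular ring contains such a pair for each [x] in [M]; this
extracts [last_coef] from the values of [f] there. *)
Lemma feval_edge_at_multilinear (S : pzRingType) (e v : S) n (j : 'I_n) f :
  e * e = e -> e * v = v -> v * e = 0 ->
  multilinear n f -> feval (edge_at e v j) f = v *~ last_coef j f.
Proof.
move=> ee ev ve fn; have n_gt0 : (0 < n)%N by apply: leq_ltn_trans (ltn_ord j).
rewrite (@additive_last_coef _ (feval (edge_at e v j))
  (fun k => v *+ (k == j)) n) //=.
  rewrite (bigD1 j) //= eqxx big1 ?addr0 // => k; rewrite -val_eqE => /negPf kj.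
  by rewrite kj mul0rz.
move=> w wn; rewrite edge_at_word // ?(perm_uniq wn) ?iota_uniq //.
by rewrite (perm_mem wn) mem_iota /=.
Qed.

(** * Proper polynomials on triangular matrices *)

Lemma foldr_perm (I : eqType) (X : Type) (op : I -> X -> X) z s t :
  (forall i j x, op i (op j x) = op j (op i x)) ->
  perm_eq s t -> foldr op z s = foldr op z t.
Proof.
move=> opC; elim: s t => [|i s IHs] t st.
  by have /perm_nilP -> : perm_eq t [::] by rewrite perm_sym.
have i_t : i \in t by rewrite -(perm_mem st) mem_head.
case/splitPr: i_t st => p q.
rewrite perm_sym -cat1s perm_catCA perm_cons perm_sym => spq.
rewrite /= (IHs _ spq) !foldr_cat /=.
by elim: p {spq} => //= k p <-; rewrite opC.
Qed.

(** Throughout, the matrices [A k] are substituted for the variables.  [M * int]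
carries the operators [op_var k], which forget the diagonal of [A k] except
for its effect on [M] through [diff_op]. *)
Section Action.
Variables (R1 R2 : comPzRingType) (M : bimodType R1 R2) (A : nat -> triang M).

(** The action on the corner of the commutator with [B], up to sign. *)
Definition diff_op (B : triang M) (x : M) : M := B.1.1 *: x - Defs.ract x B.2.

Fact ract_is_zmod_morphism (b : R2) : zmod_morphism (@Defs.ract R1 R2 M ^~ b).
Proof.
by move=> x y; apply/eqP; rewrite eq_sym subr_eq -ractDl subrK.
Qed.

Fact diff_op_is_zmod_morphism B : zmod_morphism (diff_op B).
Proof.
move=> x y; rewrite /diff_op scalerBr [Defs.ract _ _]ract_is_zmod_morphism.
by rewrite !opprB addrACA [RHS]addrACA; congr (_ + _); rewrite addrC.
Qed.

HB.instance Definition _ B := GRing.isZmodMorphism.Build M M (diff_op B)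
  (diff_op_is_zmod_morphism B).

(** Since the diagonal rings are commutative, the order of the letters before
the last will not matter. *)
Lemma diff_opC B C x : diff_op B (diff_op C x) = diff_op C (diff_op B x).
Proof.
rewrite /diff_op !scalerBr ![Defs.ract (_ - _) _]ract_is_zmod_morphism.
rewrite !scalerA -!ractA !scale_ract [B.1.1 * _]mulrC [B.2 * _]mulrC !opprB.
by rewrite addrACA [RHS]addrACA; congr (_ + _); rewrite addrC.
Qed.

Lemma lie_triang (B C : triang M) :
  lie B C = (0, diff_op B C.1.2 - diff_op C B.1.2, 0).
Proof.
apply/eqP; rewrite !xpair_eqE /= /diff_op !(mulrC C.1.1) !(mulrC C.2) !subrr !eqxx.
rewrite andbT /= opprB opprD [eqbRHS]addrACA; apply/eqP.
by congr (_ + _); rewrite addrC.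
Qed.

Definition op_var (k : nat) (v : M * int) : M * int :=
  (diff_op (A k) v.1 + (A k).1.2 *~ v.2, 0).

Let pairB (x y : M) : ((x, 0) : M * int) - (y, 0) = (x - y, 0).
Proof. by congr pair; exact: subr0. Qed.

Fact op_var_is_zmod_morphism k : zmod_morphism (op_var k).
Proof.
move=> u v; rewrite /op_var pairB raddfB mulrzBr /=.
by rewrite (opprD (diff_op _ _)) addrACA.
Qed.

HB.instance Definition _ k := GRing.isZmodMorphism.Build (M * int)%type
  (M * int)%type (op_var k) (op_var_is_zmod_morphism k).

Definition op_word (w : seq nat) (v : M * int) : M * int := foldr op_var v w.

Fact op_word_is_zmod_morphism w : zmod_morphism (op_word w).
Proof. by move=> u v; elim: w => //= k w ->; rewrite raddfB. Qed.

HB.instance Definition _ w := GRing.isZmodMorphism.Build (M * int)%type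
  (M * int)%type (op_word w) (op_word_is_zmod_morphism w).

(** The linear extension to polynomials of the action of words by [op_word]. *)
Definition op_act (v : M * int) (f : freering) : M * int :=
  \sum_(w <- msupp f) op_word w v *~ f@_w.

Lemma op_actEw (d : {fset {fmonom nat}}) v f : (msupp f `<=` d)%fset ->
  op_act v f = \sum_(w <- d) op_word w v *~ f@_w.
Proof. by move=> fd; apply: big_fset_incl => // w _ /mcoeff_outdom ->. Qed.

Lemma op_actU v (c : int) (w : {fmonom nat}) : op_act v << c *g w >> = op_word w v *~ c.
Proof. by rewrite (op_actEw _ msuppU_le) big_seq_fset1 mcoeffUU. Qed.

Fact op_act_is_zmod_morphism v : zmod_morphism (op_act v).
Proof.
move=> f g; pose d := (msupp f `|` msupp g `|` msupp (f - g))%fset.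
rewrite !(@op_actEw d) /d ?fsubsetUr //.
- by rewrite -sumrB; apply: eq_bigr => w _; rewrite mcoeffB mulrzBr.
- by rewrite -fsetUA fsetUCA fsubsetUl.
- by rewrite -fsetUA fsubsetUl.
Qed.

HB.instance Definition _ v := GRing.isZmodMorphism.Build freering (M * int)%type
  (op_act v) (op_act_is_zmod_morphism v).

Lemma op_actM v f g : op_act v (f * g) = op_act (op_act v g) f.
Proof.
rewrite malgM_def /fgmul raddf_sum; apply: eq_bigr => w1 _ /=.
rewrite raddf_sum [in RHS]raddf_sum mulrz_suml; apply: eq_bigr => w2 _ /=.
rewrite op_actU raddfMz /= -mulrzA [g@_w2 * _]mulrC.
by rewrite /op_word fmM foldr_cat.
Qed.

Lemma op_act_lie v f g : op_act v (lie f g) = op_act (op_act v g) f - op_act (op_act v f) g.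
Proof. by rewrite /lie raddfB; congr (_ - _); exact: op_actM. Qed.

Lemma op_act1 v : op_act v 1 = v.
Proof. by rewrite op_actU /op_word fm1. Qed.

Lemma op_act_fvar v k : op_act v (fvar k) = op_var k v.
Proof. by rewrite op_actU /op_word fmU. Qed.

Lemma op_actE v w : op_act v (word w) = op_word w v.
Proof.
elim: w => [|k w IHw]; rewrite /word ?big_nil ?op_act1 // big_cons op_actM op_act_fvar.
by congr op_var; exact: IHw.
Qed.

(** [g] takes the same value [x] in the corner, whether it is evaluated at the
matrices or acts by the operators; in both cases nothing else survives. *)
Definition corner (g : freering) (x : M) : Prop :=
  feval A g = (0, x, 0) /\ forall v, op_act v g = (x *~ v.2, 0).

(** Multiplying the corner [x] by [A k] on the right gives [ract x (A k).2] and
on the left [(A k).1.1 *: x]; for the operators the first product is zero and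
the second is [diff_op (A k) x]. The differences agree. *)
Lemma corner_lie g x k : corner g x -> corner (lie g (fvar k)) (- diff_op (A k) x).
Proof.
move=> [gA gv]; split=> [|v].
  rewrite feval_lie feval_var gA lie_triang /=.
  by rewrite /diff_op /= scale0r ract0r subrr sub0r.
rewrite op_act_lie !op_act_fvar !gv /= /op_var /= mulr0z addr0.
by rewrite pairB sub0r raddfMz mulNrz.
Qed.

(** On the operator side the terms [diff_op (A i) (diff_op (A j) v.1)] cancel. *)
Lemma corner_lie_var i j :
  corner (lie (fvar i) (fvar j)) (diff_op (A i) (A j).1.2 - diff_op (A j) (A i).1.2).
Proof.
split=> [|v].
  by rewrite feval_lie !feval_var lie_triang.
rewrite op_act_lie !(op_act_fvar v) !op_act_fvar /op_var pairB /=.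
rewrite !mulr0z !addr0 (raddfD (diff_op (A i))) (raddfD (diff_op (A j))) /=.
rewrite (diff_opC (A i)) (opprD (diff_op _ _)) addrACA subrr add0r.
by congr pair; rewrite mulrzBl; congr (_ - _); exact: (raddfMz (diff_op _)).
Qed.

Lemma corner_long_comm i j ks : exists x, corner (long_comm i j ks) x.
Proof.
rewrite /long_comm; move: (lie _ _) (_ - _) (corner_lie_var i j).
elim: ks => /= [|k ks IHks] g x gx; first by exists x.
exact: IHks (corner_lie k gx).
Qed.

Lemma corner_mul f g x y : corner f x -> corner g y -> corner (f * g) 0.
Proof.
move=> [fA fv] [gA gv]; split=> [|v].
  rewrite rmorphM /= fA gA; congr (_, _, _); rewrite ?mulr0 //=.
  by rewrite scale0r ract0r addr0.
by rewrite op_actM gv fv /= mulr0z mul0rz.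
Qed.

Lemma corner_proper f : proper_poly f -> exists x, corner f x.
Proof.
elim=> [|_ [cs cs0 ->]|g h _ [x [gA gv]] _ [y [hA hv]]].
- by exists 0; split=> [|v]; rewrite raddf0 // mul0rz.
- elim: cs cs0 => // c cs IHcs _; rewrite big_cons.
  have [x cx] := corner_long_comm c.1.1 c.1.2 c.2.
  case: cs IHcs => [|c' cs] IHcs; first by exists x; rewrite big_nil mulr1.
  have [y csy] := IHcs isT; exists 0; exact: corner_mul cx csy.
exists (x - y); split=> [|v].
  by rewrite raddfB /= gA hA; congr (_, _, _); rewrite /= subr0.
by rewrite raddfB /= gv hv mulrzBl pairB.
Qed.

(** Unlike the matrices, the operators treat every letter except the last in
the same way, whatever its position. *)
Lemma feval_proper f : proper_poly f -> feval A f = (0, (op_act (0, 1) f).1, 0).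
Proof. by move=> /corner_proper[x [-> ->]] /=; rewrite mulr1z. Qed.

(** The common value on [(0, 1)] of all the multilinear words ending in [j]. *)
Definition last_value (n j : nat) : M :=
  foldr (diff_op \o A) (A j).1.2 (rem j (iota 0 n)).

Lemma op_word_last n w : (0 < n)%N -> perm_eq w (iota 0 n) ->
  op_word w (0, 1) = (last_value n (last 0%N w), 0).
Proof.
case/lastP: w => [n_gt0 /perm_size|w j _ wn].
  by rewrite size_iota => n0; rewrite -n0 in n_gt0.
rewrite last_rcons /op_word foldr_rcons /last_value.
have w_rem : perm_eq (rem j (iota 0 n)) w.
  have jn : j \in iota 0 n by rewrite -(perm_mem wn) mem_rcons mem_head.
  by rewrite -(perm_cons j) perm_sym -(permPr (perm_to_rem jn)) -perm_rcons.
rewrite (foldr_perm _ _ w_rem); last by move=> i k x; exact: diff_opC.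
suff H x : foldr op_var (x, 0) w = (foldr (diff_op \o A) x w, 0).
  by rewrite /op_var /= raddf0 add0r mulr1z H.
by elim: w {wn w_rem} => //= k w ->; rewrite /op_var /= mulr0z addr0.
Qed.

Lemma op_act_multilinear n f : (0 < n)%N -> multilinear n f ->
  (op_act (0, 1) f).1 = \sum_(j < n) last_value n j *~ last_coef j f.
Proof.
move=> n_gt0.
apply: (@additive_last_coef _ (fst \o op_act (0, 1))) => // w wn.
by rewrite /= op_actE (op_word_last n_gt0 wn).
Qed.

End Action.

(** * The identities of the triangular ring *)

Lemma zmod_exponentP (M : zmodType) (c : int) :
  (forall x : M, x *~ c = 0) <-> exists d, c = d * (zmod_exponent M)%:Z.
Proof.
rewrite /zmod_exponent; case: pselect => [h|no_exp].
  case: ex_minnP => m /asboolP[m_gt0 mM] m_min; split=> [cM|[d ->] x]; last first.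
    by rewrite mulrC mulrzA -pmulrn mM mul0rz.
  exists (c %/ m)%Z; rewrite {1}(divz_eq c m); apply/eqP.
  rewrite -[X in _ == X]addr0 (inj_eq (addrI _)).
  (* The remainder of c also annihilates M, so it is 0 by minimality of m. *)
  have r_ge0 : 0 <= (c %% m)%Z by rewrite modz_ge0 // -lt0n.
  have r_lt : (c %% m)%Z < m by rewrite ltz_pmod.
  have rM (x : M) : x *~ (c %% m)%Z = 0.
    by rewrite /modz mulrzBr cM mulrC mulrzA -pmulrn mM mul0rz subr0.
  move: rM r_ge0 r_lt; case: (c %% m)%Z => // r rM _ r_lt.
  apply: contraLR r_lt => r0; rewrite -Order.TotalTheory.leNgt lez_nat; apply: m_min.
  by apply/asboolP; split; [rewrite lt0n | move=> x; rewrite pmulrn].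
split=> [cM|[d ->] x]; last by rewrite mulr0 mulr0z.
exists 0; rewrite mul0r; apply/eqP; case: eqP => // /eqP c0; case: no_exp.
exists `|c|%N; apply/asboolP; split=> [|x]; first by rewrite absz_gt0.
by case: c cM {c0} => k kM; have := kM x => // /eqP; rewrite oppr_eq0 => /eqP.
Qed.

(** Necessity comes from substituting [x] in the corner for one variable and
[e_11] for the others, sufficiency from the formula [op_act_multilinear]. *)
Lemma poly_identity_triang (R1 R2 : comPzRingType) (M : bimodType R1 R2) n f :
  (1 < n)%N -> multilinear n f -> proper_poly f ->
  poly_identity (triang M) f <->
  forall j : 'I_n, exists d, last_coef j f = d * (zmod_exponent M)%:Z.
Proof.
move=> n_gt1 fn f_proper; split=> [[_ fI] j|fM].
  apply/zmod_exponentP => x.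
  pose e : triang M := (1, 0, 0); pose v : triang M := (0, x, 0).
  have ee : e * e = e.
    by congr (_, _, _); rewrite /= ?mulr1 ?mulr0 // scaler0 ract0r addr0.
  have ev : e * v = v.
    by congr (_, _, _); rewrite /= ?mulr0 // scale1r ract0r addr0.
  have ve : v * e = 0.
    by congr (_, _, _); rewrite /= ?mulr0 ?mul0r // scaler0 ract0r addr0.
  have := feval_edge_at_multilinear j ee ev ve fn.
  have vk k : v *+ k = (0, x *+ k, 0).
    by elim: k => // k IHk; rewrite !mulrS IHk; congr (_, _, _); exact: addr0.
  rewrite fI => /esym; case: (last_coef j f) => k.
    by rewrite -pmulrn vk => -[].
  by rewrite NegzE !mulrNz -!pmulrn vk => -[].
split=> [|A]; first by rewrite mcoeff1_feval feval_proper_comm.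
rewrite (feval_proper _ f_proper) (op_act_multilinear _ (ltnW n_gt1) fn).
by rewrite big1 // => j _; exact: (proj2 (zmod_exponentP M _) (fM j)).
Qed.

(** * The Specht module of the shape (n-1, 1) *)

Lemma ZS_mulrzE n (z : ZS n) c (s : 'S_n) : (z *~ c) s = z s * c.
Proof.
case: c => k; first by rewrite -pmulrn ffunMnE -mulr_natr natz.
by rewrite NegzE mulrNz -pmulrn ffunE ffunMnE mulrN -mulr_natr natz.
Qed.

Section PointSums.
Variables (n : nat) (q : 'I_n).

(** The combination, with coefficients [c k], of the sums of all permutations
that send [q] to [k]. *)
Definition point_sum (c : 'I_n -> int) : ZS n := [ffun s : 'S_n => c (s q)].

Lemma mul_point_sum z c :
  z * point_sum c = point_sum (fun k => \sum_(s : 'S_n) z s * c ((s^-1)%g k)).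
Proof.
by apply/ffunP=> s; rewrite !ffunE; apply: eq_bigr => t _; rewrite ffunE permM.
Qed.

Lemma mul_gr_point_sum s c :
  gr s * point_sum c = point_sum (fun k => c ((s^-1)%g k)).
Proof.
rewrite mul_point_sum; apply/ffunP=> t; rewrite !ffunE (bigD1 s) //= big1.
  by rewrite ffunE eqxx mul1r addr0.
by move=> u /negPf us; rewrite ffunE us mul0r.
Qed.

Lemma point_sum_eval c k : point_sum c (tperm q k) = c k.
Proof. by rewrite ffunE tpermL. Qed.

Definition specht_map (f : freemod n) : (ZS n)^o :=
  point_sum (fun k => last_coef k f).

Fact specht_map_is_zmod_morphism : zmod_morphism specht_map.
Proof. by move=> f g; apply/ffunP=> s; rewrite !ffunE raddfB. Qed.

(** After [x_i] is renamed to [x_(t i)], the monomials that end in [x_k] are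
those that ended in the preimage of [k] under [t]. *)
Fact specht_map_is_scalable : scalable specht_map.
Proof.
move=> z f; rewrite -[RHS]/(z * point_sum _) mul_point_sum.
apply/ffunP=> s; rewrite !ffunE [LHS]raddf_sum; apply: eq_bigr => t _.
rewrite raddfMz /= -(perm_nat_ord t^-1) -[in RHS](last_coef_perm t).
by rewrite perm_natM mulVg perm_nat1 -mulrzl intz.
Qed.

HB.instance Definition _ := GRing.isZmodMorphism.Build (freemod n) (ZS n)^o
  specht_map specht_map_is_zmod_morphism.
HB.instance Definition _ := GRing.isScalable.Build (ZS n) (freemod n) (ZS n)^o
  _ specht_map specht_map_is_scalable.

End PointSums.

(** [q] is the entry of the second row, [p] the entry above it: the other columns
have one entry, so column-preserving permutations move only [p] and [q]. *)
Lemma hook_stabilizers n (T : seq (seq 'I_n)) :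
    (1 < n)%N -> is_tableau T [:: n.-1; 1%N] ->
  exists p q : 'I_n, [/\ p != q, row_stab T = [set s : 'S_n | s q == q]
    & col_stab T = [set 1%g; tperm p q]].
Proof.
move=> n_gt1 /andP[/eqP].
case: T => [|r [|r' [|? ?]]] //= [sz_r sz_r'] fl.
case: r' sz_r' fl => [|q [|? ?]] //= _ fl.
case: r sz_r fl => [|p r] /=; first by case: n n_gt1 q => [|[|n]].
move=> _ fl; exists p, q; move: fl; set r1 := p :: r; rewrite -[p :: _]/(r1 ++ [:: q]).
set T := [:: r1; [:: q]] => fl.
have : uniq (r1 ++ [:: q]) by rewrite (perm_uniq fl) enum_uniq.
rewrite cats1 rcons_uniq => /andP[q_r1 r1_uniq].
have in_r1 i : (i \in r1) = (i != q).
  have := mem_enum 'I_n i; rewrite -(perm_mem fl) mem_cat mem_seq1.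
  by case: eqVneq => [->|]; rewrite ?(negPf q_r1) // orbF.
have pq : p != q by rewrite -in_r1 mem_head.
have rowE i : tab_row T i = (i == q).
  by rewrite /tab_row /T /= in_r1 mem_seq1; case: eqP.
have colE i : tab_col T i = if i == q then 0%N else index i r1.
  rewrite /tab_col rowE; case: eqP => [->|] //=; by rewrite eqxx.
have col0 i : (tab_col T i == 0%N) = (i == p) || (i == q).
  rewrite colE; case: (eqVneq i q) => [|_]; first by rewrite orbT.
  by rewrite orbF /= [p == i]eq_sym; case: (i == p).
split=> //; apply/setP=> s; rewrite !inE; last first.
  apply/forallP/idP => [s_col|/orP[/eqP -> i|/eqP -> i]]; last 2 first.
  - by rewrite perm1.
  - have pE : tab_col T p = 0%N by apply/eqP; rewrite col0 eqxx.
    have qE : tab_col T q = 0%N by apply/eqP; rewrite col0 eqxx orbT.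
    by case: tpermP => [->|->|//]; rewrite pE qE.
  (* Off p and q, the column determines the entry. *)
  have s_fix k : k != p -> k != q -> s k = k.
    move=> kp kq; have : tab_col T (s k) != 0%N.
      by rewrite (eqP (s_col k)) col0 negb_or kp.
    rewrite col0 negb_or => /andP[skp skq].
    have := eqP (s_col k); rewrite !colE (negPf skq) (negPf kq).
    by move/(index_inj k); apply; rewrite in_r1.
  have s_pq k : (k == p) || (k == q) -> (s k == p) || (s k == q).
    by rewrite -!col0 (eqP (s_col k)).
  have : (s p == p) || (s p == q) by apply: s_pq; rewrite eqxx.
  have : (s q == p) || (s q == q) by apply: s_pq; rewrite eqxx orbT.
  have sq_neq_sp : s q != s p by rewrite (inj_eq perm_inj) eq_sym.
  case/orP=> /eqP sq; case/orP=> /eqP sp; rewrite sq sp ?eqxx // in sq_neq_sp *.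
    apply/orP; right; apply/eqP/permP=> k.
    by case: tpermP => [->|->|/eqP kp /eqP kq] //; exact: s_fix.
  apply/orP; left; apply/eqP/permP=> k; rewrite perm1.
  case: (eqVneq k p) => [-> //|kp]; case: (eqVneq k q) => [-> //|kq].
  exact: s_fix.
apply/forallP/idP => [/(_ q)|/eqP sq i]; rewrite !rowE ?eqxx.
  by case: (s q == q).
by rewrite -{1}sq (inj_eq perm_inj).
Qed.

Section HookSpecht.
Variables (n : nat) (T : seq (seq 'I_n)) (p q : 'I_n).
Hypotheses (pq : p != q) (rowT : row_stab T = [set s : 'S_n | s q == q])
  (colT : col_stab T = [set 1%g; tperm p q]).

(** The row sum is the sum of the permutations that fix [q], and multiplying it
by the transposition gives the sum of those that send [q] to [p]. *)
Lemma hook_generator :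
  col_sum T * row_sum T = point_sum q (fun k => (k == q)%:Z - (k == p)%:Z).
Proof.
have -> : row_sum T = point_sum q (fun k => (k == q)%:Z).
  apply/ffunP=> s; rewrite /row_sum rowT sum_ffunE ffunE.
  under eq_bigr => t _ do rewrite ffunE.
  case: (boolP (s q == q)) => sq.
    rewrite (bigD1 s) ?inE //= eqxx big1 ?addr0 // => t /andP[_].
    by rewrite eq_sym => /negPf ->.
  rewrite big1 // => t; rewrite inE => tq.
  by case: eqP => // st; rewrite st tq in sq.
have -> : col_sum T = gr 1 - gr (tperm p q).
  rewrite /col_sum colT big_setU1 /= ?big_set1; last first.
    rewrite inE eq_sym; apply: contraNneq pq => /permP/(_ p).
    by rewrite tpermL perm1 => ->.
  by rewrite odd_perm1 odd_tperm pq expr0 expr1 mulr1z mulrNz mulr1z.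
rewrite mulrBl !mul_gr_point_sum; apply/ffunP=> s; rewrite !ffunE.
rewrite invg1 perm1 tpermV; congr (_ - (nat_of_bool _)%:Z).
by rewrite -(inj_eq (@perm_inj _ (tperm p q)) (s q)) tpermL.
Qed.

(** For [k != p] the transposition of [q] and [k] sends [delta_q - delta_p] to
[delta_k - delta_p], and these vectors span those of sum zero. *)
Lemma point_sum_specht (c : 'I_n -> int) :
  \sum_k c k = 0 -> (point_sum q c : (ZS n)^o) \in specht T.
Proof.
move=> c0; apply/asboolP.
exists (\sum_(k | k != p) gr (tperm q k) *~ c k).
rewrite hook_generator mulr_suml; apply/ffunP=> s; rewrite sum_ffunE ffunE.
have kE k : k != p ->
    (gr (tperm q k) *~ c k * point_sum q (fun k => (k == q)%:Z - (k == p)%:Z)) s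
    = ((s q == k)%:Z - (s q == p)%:Z) * c k.
  move=> kp; rewrite mulrzAl mul_gr_point_sum ZS_mulrzE ffunE.
  congr (((nat_of_bool _)%:Z - (nat_of_bool _)%:Z) * _).
    by rewrite -(inj_eq (@perm_inj _ (tperm q k))) permKV tpermL.
  by rewrite -(inj_eq (@perm_inj _ (tperm q k))) permKV tpermD // eq_sym.
rewrite (eq_bigr _ kE); move: (s q) => j.
case: (eqVneq j p) => [->|jp].
  move: c0; rewrite (bigD1 p) //= => /eqP; rewrite addr_eq0 => /eqP ->.
  rewrite -sumrN; apply: eq_bigr => k /negPf kp.
  by rewrite eq_sym kp sub0r mulN1r.
rewrite (bigD1 j) //= eqxx subr0 mul1r big1 ?addr0 // => k /andP[_ /negPf kj].
by rewrite eq_sym kj subr0 mul0r.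
Qed.

(** The Specht module is cyclic, so its generator suffices; up to sign, it is
the image of a long commutator starting with [x_p] and [x_q]. *)
Lemma specht_map_surj u : (1 < n)%N -> u \in specht T ->
  exists2 f, f \in proper_multilinear n & specht_map q f = u.
Proof.
move=> n_gt1 /asboolP[z ->].
pose ks := [seq k <- iota 0 n | k \notin [:: val p; val q]].
have pqks_uniq : uniq [:: val p, val q & ks].
  rewrite /= inE negb_or val_eqE pq filter_uniq ?iota_uniq // andbT.
  by rewrite !mem_filter !inE !eqxx ?orbT.
have pqks : perm_eq [:: val p, val q & ks] (iota 0 n).
  apply: uniq_perm => //; first exact: iota_uniq.
  move=> k; rewrite !inE mem_filter !inE negb_or mem_iota /=.
  by case: eqP => [->|_]; case: eqP => [->|_] //=; rewrite ltn_ord.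
pose f : freemod n := long_comm p q ks *~ (-1) ^+ size ks.
have fP : f \in proper_multilinear n.
  apply/asboolP; split; apply: zspanMz.
    apply/multilinearP; have := perm_span_long_comm p q ks.
    apply: (@zspan_morph _ _ _ _ idfun) => ? [w wpq ->].
    by exists w => //; rewrite (perm_trans wpq).
  by apply: zspan_gen; exists [:: (val p, val q, ks)]; rewrite ?big_seq1.
exists (z *: f); first exact: rpredZ.
rewrite linearZ /= hook_generator; congr (z * _); apply/ffunP=> s.
rewrite !ffunE raddfMz /= last_coef_long_comm // !val_eqE.
by rewrite -mulrzl intz mulrA -exprMn mulrNN mulr1 expr1n mul1r.
Qed.

Lemma specht_map_mem f : (1 < n)%N ->
  f \in proper_multilinear n -> specht_map q f \in specht T.
Proof.
move=> n_gt1 /asboolP[fn f_proper]; apply: point_sum_specht.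
by rewrite sum_last_coef ?(ltnW n_gt1) // feval_proper_comm.
Qed.

(** The coefficients divided by [m] still have sum zero, except perhaps if
[m = 0], where all the coefficients vanish. *)
Lemma specht_map_mul f m : (1 < n)%N -> f \in proper_multilinear n ->
  (specht_map q f \in specht_mul T m) <->
  forall k : 'I_n, exists d, last_coef k f = d * m%:Z.
Proof.
move=> n_gt1 fP; split=> [/asboolP[v /(specht_map_surj n_gt1)[g _ <-] fg] k|].
  exists (last_coef k g).
  have /ffunP/(_ (tperm q k)) := fg.
  by rewrite ffunMnE !point_sum_eval => ->; rewrite -mulr_natr natz.
case/fin_all_exists => d fd; apply/asboolP.
have [m0|m_neq0] := eqVneq m 0%N.
  exists 0; rewrite ?rpred0 // mul0rn; apply/ffunP=> s.
  by rewrite !ffunE fd m0 mulr0.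
exists (point_sum q d).
  apply: point_sum_specht; apply/eqP; have /asboolP[fn f_proper] := fP.
  have /eqP := sum_last_coef (ltnW n_gt1) fn.
  rewrite feval_proper_comm // (eq_bigr _ (fun k _ => fd k)) -mulr_suml mulf_eq0.
  by case/orP => //; rewrite eqz_nat (negPf m_neq0).
by apply/ffunP=> s; rewrite ffunMnE !ffunE fd -mulr_natr natz.
Qed.

End HookSpecht.

(** * The isomorphism *)

Theorem theorem6 (R1 R2 : comPzRingType) (M : bimodType R1 R2)
    (n : nat) (hn : (2 <= n)%N)
    (T : seq (seq 'I_n)) (hT : is_tableau T [:: n.-1; 1%N]) :
  exists phi : {linear quotmod (proper_multilinear n)
                          (proper_multilinear_Id n (triang M)) ->
                       quotmod (specht T) (specht_mul T (zmod_exponent M))},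
    bijective phi.
Proof.
have [p [q [pq rowT colT]]] := hook_stabilizers hn hT.
apply: (quotmod_iso (F := specht_map q)) => [f|u|f fP].
- exact: (specht_map_mem pq rowT colT hn).
- exact: (specht_map_surj pq rowT colT hn).
have /asboolP[fn f_proper] := fP.
have identityP := poly_identity_triang M hn fn f_proper.
apply/idP/andP => [fm|[_ /asboolP fI]].
  split=> //; apply/asboolP; apply: (proj2 identityP).
  exact: (proj1 (specht_map_mul pq rowT colT _ hn fP) fm).
by apply: (proj2 (specht_map_mul pq rowT colT _ hn fP)); exact: (proj1 identityP).
Qed.
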